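(* Let $(X,d)$ be a metric space, $A\subset X$ a nonempty closed set, and let $\mathbf{F}:\Delta\to(0,1]$ be a Tietze extender. Let $\Theta_{\mathbf{F}}:\ell_\infty(A)\to\ell_\infty(X)$ be the extension operator defined by $$\Theta_{\mathbf{F}}[\varphi]=\Omega_{\mathbf{F}}[\varphi^+]-\Omega_{\mathbf{F}}[\varphi^-],\quad\varphi\in\ell_\infty(A),$$ where for $\psi\in\ell_\infty^+(A)$ the function $\Omega_{\mathbf{F}}[\psi]:X\to[0,+\infty)$ is given by $\Omega_{\mathbf{F}}[\psi](p)=\psi(p)$ for $p\in A$ and $\Omega_{\mathbf{F}}[\psi](p)=\sup_{a\in A}\psi(a)\cdot\mathbf{F}\big(d(a,p),d(p,A)\big)$ for $p\in X\setminus A$. Then $\Theta_{\mathbf{F}}$ is a $2$-Lipschitz map which is positive and positively homogeneous. Moreover, it preserves the norm and both continuity and uniform continuity.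
   Context: $d(p,A)=\inf\{d(p,a):a\in A\}$; subsets of $X$ carry the restricted metric. Let $\Delta=\{(s,t)\in\mathbb{R}^2: s\ge t>0\}$. A function $\mathbf{F}:\Delta\to(0,1]$ is called a Tietze extender if: (i) $\lim_{t\to0}\mathbf{F}(t,t)=1$, and $\lim_{t\to0}\mathbf{F}(s,t)=0$ for every fixed $s>0$; (ii) for every fixed $t>0$, $\mathbf{F}(\cdot,t)$ is decreasing (not necessarily strictly); (iii) for every $\tau>0$, $\mathbf{F}(s,t)$ is uniformly continuous on $\{(s,t): s\ge t\ge\tau\}$. For a nonempty set $Z$, $\ell_\infty(Z)$ is the space of all bounded real-valued functions on $Z$ with the sup-norm $\|\varphi\|=\sup|\varphi|$ and the pointwise order, and $\ell_\infty^+(Z)$ is the set of its members with values in $[0,+\infty)$. For $\varphi\in\ell_\infty(A)$, $\varphi^+=\max\{\varphi,0\}$ and $\varphi^-=\max\{-\varphi,0\}$ pointwise. An operator $\Theta:\ell_\infty(A)\to\ell_\infty(X)$ is: an extension operator if $\Theta[\varphi]\upharpoonright A=\varphi$ for all $\varphi$; $2$-Lipschitz if $\|\Theta[\varphi]-\Theta[\psi]\|\le2\|\varphi-\psi\|$ for all $\varphi,\psi$; positive if $\Theta[\ell_\infty^+(A)]\subset\ell_\infty^+(X)$; positively homogeneous if $\Theta[\lambda\varphi]=\lambda\Theta[\varphi]$ for all $\varphi\in\ell_\infty(A)$ and $\lambda\ge0$. It preserves the norm if $\|\Theta[\varphi]\|=\|\varphi\|$ for every $\varphi\in\ell_\infty(A)$,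 and preserves continuity (respectively, uniform continuity) if $\Theta[\varphi]$ is continuous (respectively, uniformly continuous) on $X$ whenever $\varphi\in\ell_\infty(A)$ is continuous (respectively, uniformly continuous) on $A$. *)

(* Defs.v *)
From HB Require Import structures.
From mathcomp Require Import all_boot all_order all_algebra.
From mathcomp Require Import all_classical all_reals all_analysis.

Set Implicit Arguments.
Unset Strict Implicit.
Unset Printing Implicit Defensive.

Import Order.TTheory GRing.Theory Num.Theory.
Import numFieldNormedType.Exports.

Local Open Scope classical_set_scope.
Local Open Scope ring_scope.

Definition dist_set (R : realType) (X : metricType R) (p : X) (A : set X) : R :=
  inf [set mdist p a | a in A].

(* A function on Delta = {(s, t) | s >= t > 0} is represented by a total
   function F : R -> R -> R; only its values on Delta are constrained here,
   and [Omega] below evaluates F on Delta only when A is closed and nonempty.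
   On [t >= tau] the uniform structure is the one induced by R * R. *)
Record tietze_extender (R : realType) (F : R -> R -> R) : Prop := {
  tietze_range : forall s t : R, 0 < t -> t <= s -> 0 < F s t <= 1 ;
  tietze_diag : F t t @[t --> 0^'+] --> (1 : R) ;
  tietze_col : forall s : R, 0 < s -> F s t @[t --> 0^'+] --> (0 : R) ;
  tietze_decr : forall t : R, 0 < t -> {in `[t, +oo[ &, nonincreasing_fun (F^~ t)} ;
  tietze_unif : forall tau : R, 0 < tau ->
    unif_continuous
      (fun st : [set st : R * R | tau <= st.2 <= st.1] =>
         F (\val st).1 (\val st).2)
}.

Definition ell_infty (R : realType) (Z : Type) : set (Z -> R) := bounded_fun.

Definition ell_infty_pos (R : realType) (Z : Type) : set (Z -> R) :=
  [set phi | ell_infty phi /\ forall z, 0 <= phi z].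

(* For phi bounded and Z nonempty this is the supremum of |phi|. *)
Definition sup_norm (R : realType) (Z : Type) (phi : Z -> R) : R :=
  sup (range (fun z => `|phi z|)).

(* Operators from ell_infty(Y) to ell_infty(Z) are maps on all real functions
   whose properties are only required on ell_infty(Y). *)
Section operators.
Variables (R : realType) (Y Z : Type).
Implicit Type T : (Y -> R) -> (Z -> R).

Definition ell_infty_operator T := set_fun (@ell_infty R Y) (@ell_infty R Z) T.

Definition lipschitz_operator (k : R) T :=
  forall phi psi, ell_infty phi -> ell_infty psi ->
    sup_norm (T phi \- T psi) <= k * sup_norm (phi \- psi).

Definition positive_operator T :=
  T @` @ell_infty_pos R Y `<=` @ell_infty_pos R Z.

Definition pos_homogeneous_operator T :=
  forall phi (lambda : R), ell_infty phi -> 0 <= lambda ->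
    T (fun y => lambda * phi y) = (fun z => lambda * T phi z).

Definition preserves_norm T :=
  forall phi, ell_infty phi -> sup_norm (T phi) = sup_norm phi.

End operators.

Definition extension_operator (R : realType) (X : Type) (A : set X)
    (T : (A -> R) -> (X -> R)) :=
  forall phi : A -> R, ell_infty phi -> forall a : A, T phi (\val a) = phi a.

Definition preserves_continuity (R : realType) (Y Z : topologicalType)
    (T : (Y -> R) -> (Z -> R)) :=
  forall phi : Y -> R, ell_infty phi -> continuous phi -> continuous (T phi).

Definition preserves_unif_continuity (R : realType) (Y Z : uniformType)
    (T : (Y -> R) -> (Z -> R)) :=
  forall phi : Y -> R, ell_infty phi ->
    unif_continuous phi -> unif_continuous (T phi).

Section tietze_operator.
Variables (R : realType) (X : metricType R) (A : set X) (F : R -> R -> R).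

Definition Omega (psi : A -> R) (p : X) : R :=
  match pselect (A p) with
  | left Ap => psi (exist _ p (mem_set Ap))
  | right _ =>
      sup (range (fun a : A => psi a * F (mdist (\val a) p) (dist_set p A)))
  end.

Definition Theta (phi : A -> R) : X -> R := Omega phi^\+ \- Omega phi^\-.

End tietze_operator.

Arguments Omega {R X} A F psi p.
Arguments Theta {R X} A F phi.

(* Main.v *)
Require Import Defs.
From mathcomp Require Import all_boot all_order all_algebra.
From mathcomp Require Import all_classical all_reals all_analysis.
From mathcomp Require Import lra.

Set Implicit Arguments.
Unset Strict Implicit.
Unset Printing Implicit Defensive.

Import Order.TTheory GRing.Theory Num.Theory.
Import numFieldNormedType.Exports.

Local Open Scope classical_set_scope.
Local Open Scope ring_scope.

(** Off [A], [Omega psi p] is a supremum of values of [psi] with weights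
    [F (d (a, p)) (d (p, A))] in (0, 1].  As the weights are at most 1, [Omega] is nonnegative, bounded by any bound of [psi] and
    1-Lipschitz in [psi] for the sup-norm.  The positive and the negative part
    of [phi] are both 1-Lipschitz in [phi], so the values of [Omega] at each
    are too, and their difference [Theta] is 2-Lipschitz; and since [Omega] of each part takes values in [[0, M]]
    whenever [|phi| <= M], the difference takes values in [[-M, M]], which
    together with the extension property gives preservation of the norm.

    For continuity there are two regimes.  At distance at least [tau] from [A]
    the uniform continuity of [F] on [{s >= t >= tau}] makes all the weights
    vary little at once, so that [Omega psi] is uniformly continuous there for
    every bounded [psi] ([Omega_unif_away]).  Near a point [b] of [A], where
    [t = d (q, A)] is small, the points of [A] far from [b] have weight at most
    [F s t] for some fixed [s > 0], hence negligible; a point [a] that almost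
    realises the distance from [q] to [A] is close to [b] and has weight close
    to [F t t], hence close to 1.  So [Omega psi q] is close to [psi b]
    ([Omega_near_set]).  In this second estimate the radius depends only on
    the bound of [psi] and on its modulus of continuity at [b].  Used at a
    single point it gives continuity; if the modulus is uniform it holds at
    all points of [A] with the same radius, and combined with the first regime
    it gives uniform continuity. *)

(** * Bounded functions, suprema and moduli of continuity *)

Section real_functions.
Variable R : realType.

Lemma ell_inftyP (Z : Type) (f : Z -> R) :
  ell_infty f <-> exists M, forall z, `|f z| <= M.
Proof.
split=> [/pinfty_ex_gt0[M _ fM]|[M fM]].
  by exists M => z; exact: fM.
exists M; split; first exact: num_real.
by move=> x Mx z _; exact: le_trans (fM z) (ltW Mx).
Qed.

Lemma le_sup_norm (Z : Type) (f : Z -> R) z :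
  ell_infty f -> `|f z| <= sup_norm f.
Proof.
move=> /ell_inftyP[M fM]; apply: ub_le_sup; last by exists z.
by exists M => _ [y _ <-].
Qed.

Lemma sup_norm_le (Z : Type) (f : Z -> R) M (z : Z) :
  (forall z, `|f z| <= M) -> sup_norm f <= M.
Proof. by move=> fM; apply: ge_sup; [exists `|f z|, z|move=> _ [y _ <-]]. Qed.

Lemma dist_sup_range (I : Type) (f g : I -> R) e (i : I) :
  ell_infty f -> ell_infty g -> (forall i, `|f i - g i| <= e) ->
  `|sup (range f) - sup (range g)| <= e.
Proof.
have half (h k : I -> R) : ell_infty k -> (forall i, `|h i - k i| <= e) ->
    sup (range h) <= sup (range k) + e.
  move=> /ell_inftyP[M kM] hk; apply: ge_sup; first by exists (h i), i.
  move=> _ [j _ <-]; have : k j <= sup (range k).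
    apply: ub_le_sup; last by exists j.
    by exists M => _ [l _ <-]; exact: le_trans (ler_norm _) (kM l).
  by have := hk j; rewrite ler_norml; lra.
move=> bf bg fg; rewrite ler_norml; apply/andP; split.
  by rewrite lerBrDr addrC lerBlDr half// => j; rewrite distrC.
by rewrite lerBlDl half.
Qed.

Lemma dist_max0 (x y : R) : `|Num.max x 0 - Num.max y 0| <= `|x - y|.
Proof.
have [x0|x0] := leP x 0; have [y0|y0] := leP y 0.
- by rewrite subrr normr0.
- by rewrite sub0r normrN distrC !ger0_norm; lra.
- by rewrite subr0 !ger0_norm; lra.
- by [].
Qed.

Lemma dist_max0N (x y : R) : `|Num.max (- x) 0 - Num.max (- y) 0| <= `|x - y|.
Proof. by rewrite (le_trans (dist_max0 _ _))// opprK addrC distrC. Qed.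

(** Together with its uniform analogue below, this passes from [phi] to its
    positive and negative parts. *)
Lemma continuous_lip1 (T : topologicalType) (f g : T -> R) :
  (forall x y, `|g x - g y| <= `|f x - f y|) -> continuous f -> continuous g.
Proof.
move=> gf cf x; apply/cvgrPdist_lt => e e0.
move: (cf x) => /cvgrPdist_lt/(_ _ e0); apply: filterS => y.
exact: le_lt_trans.
Qed.

Lemma unif_continuous_realP (U : pseudoMetricType R) (f : U -> R) :
  unif_continuous f <-> forall e, 0 < e -> exists2 d, 0 < d &
    forall x y, ball x d y -> `|f x - f y| < e.
Proof.
rewrite (unif_continuousP (V := R : pseudoMetricType R)).
split=> uf e /uf[d d0 df]; exists d => //.
  by move=> x y xy; exact: (df (x, y)).
by move=> [x y] xy; exact: df.
Qed.

Lemma unif_continuous_lip1 (U : pseudoMetricType R) (f g : U -> R) :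
  (forall x y, `|g x - g y| <= `|f x - f y|) ->
  unif_continuous f -> unif_continuous g.
Proof.
move=> gf /unif_continuous_realP uf.
apply/unif_continuous_realP => e /uf[d d0 df].
by exists d => // x y /df; exact: le_lt_trans.
Qed.

Lemma unif_continuousB (U : pseudoMetricType R) (f g : U -> R) :
  unif_continuous f -> unif_continuous g -> unif_continuous (f \- g).
Proof.
move=> /unif_continuous_realP uf /unif_continuous_realP ug.
apply/unif_continuous_realP => e e0.
have e20 : 0 < e / 2 by rewrite divr_gt0.
have [d1 d10 fd] := uf _ e20; have [d2 d20 gd] := ug _ e20.
exists (Num.min d1 d2); first by rewrite lt_min d10.
move=> x y xy.
have xy1 : ball x d1 y by apply: le_ball xy; rewrite ge_min lexx.
have xy2 : ball x d2 y by apply: le_ball xy; rewrite ge_min lexx orbT.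
by have := fd x y xy1; have := gd x y xy2; rewrite /= !ltr_norml; lra.
Qed.

End real_functions.

(** * The distance to a set *)

Section dist_set.
Variables (R : realType) (X : metricType R) (A : set X).
Hypothesis A0 : A !=set0.

Let dist_has_inf p : has_inf [set mdist p a | a in A].
Proof.
have [a Aa] := A0; split; first by exists (mdist p a), a.
by exists 0 => _ [b _ <-]; exact: mdist_ge0.
Qed.

Lemma dist_set_le p a : A a -> dist_set p A <= mdist p a.
Proof. by move=> Aa; apply: ge_inf; [exact: (dist_has_inf p).2|exists a]. Qed.

Lemma dist_set_approx p e : 0 < e ->
  exists2 a, A a & mdist p a < dist_set p A + e.
Proof. by move=> /inf_adherent/(_ (dist_has_inf p))[_ [a Aa <-]]; exists a. Qed.

Lemma dist_set_lip p q : dist_set p A <= mdist p q + dist_set q A.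
Proof.
apply/ler_addgt0Pl => e /(dist_set_approx q)[a Aa qa].
have := dist_set_le p Aa; have := metric_triangle p q a; lra.
Qed.

Lemma dist_set_gt0 p : closed A -> ~ A p -> 0 < dist_set p A.
Proof.
move=> clA Ap; rewrite ltNge; apply/negP => p0; apply: Ap.
apply: clA => B /nbhs_ballP[e /= e0 eB].
have [a Aa pa] := dist_set_approx p e0; exists a; split=> //; apply: eB.
by rewrite ballEmdist /=; lra.
Qed.

End dist_set.

(** * Tietze extenders in epsilon-delta form *)

Section extender.
Variables (R : realType) (F : R -> R -> R).
Hypothesis FF : tietze_extender F.

Lemma extender_diag e : 0 < e ->
  exists2 d, 0 < d & forall t, 0 < t < d -> 1 - e < F t t.
Proof.
move=> e0; have /cvgrPdist_lt/(_ e e0)[d /= d0 dF] := tietze_diag FF.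
exists d => // t /andP[t0 td]; have := dF t.
rewrite /= sub0r normrN gtr0_norm//.
by move=> /(_ td t0); rewrite ltr_norml; lra.
Qed.

Lemma extender_col s e : 0 < s -> 0 < e ->
  exists2 d, 0 < d & forall t, 0 < t < d -> F s t < e.
Proof.
move=> s0 e0; have /cvgrPdist_lt/(_ e e0)[d /= d0 dF] := tietze_col FF s0.
exists d => // t /andP[t0 td]; have := dF t.
rewrite /= sub0r normrN gtr0_norm//.
by move=> /(_ td t0); rewrite ltr_norml; lra.
Qed.

Lemma extender_decr s s' t : 0 < t -> t <= s -> s <= s' -> F s' t <= F s t.
Proof.
move=> t0 ts ss'; apply: (tietze_decr FF t0) => //; rewrite in_itv/= andbT//.
exact: le_trans ss'.
Qed.

Lemma extender_unif tau e : 0 < tau -> 0 < e -> exists2 d, 0 < d &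
  forall s t s' t', tau <= t <= s -> tau <= t' <= s' ->
    `|s - s'| < d -> `|t - t'| < d -> `|F s t - F s' t'| < e.
Proof.
move=> tau0 e0; have := tietze_unif FF tau0.
move=> /unif_continuous_realP/(_ e e0)[d d0 dF]; exists d => //.
move=> s t s' t' st st' ss tt.
pose D := [set u : R * R | tau <= u.2 <= u.1].
pose u : D := exist _ (s, t) (mem_set (st : D (s, t))).
pose v : D := exist _ (s', t') (mem_set (st' : D (s', t'))).
exact: (dF u v).
Qed.

End extender.

(** * The operator on nonnegative functions *)

Section Omega.
Variables (R : realType) (X : metricType R) (A : set X) (F : R -> R -> R).
Hypotheses (A0 : A !=set0) (clA : closed A) (FF : tietze_extender F).
Implicit Types (psi : A -> R) (a b : A) (p q : X).

(* A base point: the suprema defining [Omega] need a nonempty index set. *)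
Let a0 : A := exist _ (projT1 (cid A0)) (mem_set (projT2 (cid A0))).

Lemma Omega_val psi a : Omega A F psi (\val a) = psi a.
Proof.
rewrite /Omega; case: pselect => [Aa|]; last by case; exact: set_valP.
by congr psi; exact: val_inj.
Qed.

Lemma Omega_out psi p : ~ A p -> Omega A F psi p =
  sup (range (fun a : A => psi a * F (mdist (\val a) p) (dist_set p A))).
Proof. by rewrite /Omega; case: pselect. Qed.

Lemma dist_set_le_val p a : dist_set p A <= mdist (\val a) p.
Proof. by rewrite metric_sym; apply: dist_set_le => //; exact: set_valP. Qed.

Lemma weight_itv p a : ~ A p -> 0 < F (mdist (\val a) p) (dist_set p A) <= 1.
Proof.
move=> Ap; apply: (tietze_range FF); first exact: dist_set_gt0.
exact: dist_set_le_val.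
Qed.

Lemma weighted_bound psi M p : ~ A p -> (forall a, `|psi a| <= M) ->
  forall a, `|psi a * F (mdist (\val a) p) (dist_set p A)| <= M.
Proof.
move=> Ap psiM a; have /andP[F0 F1] := weight_itv a Ap.
by rewrite normrM (gtr0_norm F0) (le_trans _ (psiM a))// ler_piMr.
Qed.

Lemma ell_infty_weighted psi p : ~ A p -> ell_infty psi ->
  ell_infty (fun a : A => psi a * F (mdist (\val a) p) (dist_set p A)).
Proof.
move=> Ap /ell_inftyP[M psiM]; apply/ell_inftyP; exists M.
exact: weighted_bound.
Qed.

Lemma Omega_le psi p y : ~ A p ->
  (forall a, psi a * F (mdist (\val a) p) (dist_set p A) <= y) ->
  Omega A F psi p <= y.
Proof.
move=> Ap psiy; rewrite Omega_out//; apply: ge_sup; last by move=> _ [a _ <-].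
by eexists; exists a0.
Qed.

Lemma le_Omega psi p a : ~ A p -> ell_infty psi ->
  psi a * F (mdist (\val a) p) (dist_set p A) <= Omega A F psi p.
Proof.
move=> Ap /(ell_infty_weighted Ap)/ell_inftyP[M psiM]; rewrite Omega_out//.
apply: ub_le_sup; last by exists a.
by exists M => _ [b _ <-]; exact: le_trans (ler_norm _) (psiM b).
Qed.

Lemma Omega_itv psi M p : (forall a, 0 <= psi a <= M) ->
  0 <= Omega A F psi p <= M.
Proof.
move=> psiM; have [Ap|Ap] := pselect (A p).
  by rewrite -[p]/(\val (exist _ p (mem_set Ap) : A)) Omega_val.
have bpsi a : `|psi a| <= M by rewrite ger0_norm; case/andP: (psiM a).
apply/andP; split.
  apply: le_trans (le_Omega a0 Ap _); last by apply/ell_inftyP; exists M.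
  have /andP[/ltW ? _] := weight_itv a0 Ap.
  by have /andP[? _] := psiM a0; exact: mulr_ge0.
apply: Omega_le => // a.
exact: le_trans (ler_norm _) (weighted_bound Ap bpsi a).
Qed.

(** The supremum is 1-Lipschitz in its family, and the weights, being at most
    1, do not increase the distance between the two families. *)
Lemma Omega_lip psi psi' e p : ell_infty psi -> ell_infty psi' ->
  (forall a, `|psi a - psi' a| <= e) ->
  `|Omega A F psi p - Omega A F psi' p| <= e.
Proof.
move=> bpsi bpsi' psie; have [Ap|Ap] := pselect (A p).
  by rewrite -[p]/(\val (exist _ p (mem_set Ap) : A)) !Omega_val.
rewrite !Omega_out//; apply: dist_sup_range a0 _ _ _;
  do ?exact: ell_infty_weighted.
by move=> a; rewrite -mulrBl; exact: (weighted_bound (psi := psi \- psi')).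
Qed.

Lemma OmegaZ psi l p : ell_infty psi -> 0 <= l ->
  Omega A F (fun a => l * psi a) p = l * Omega A F psi p.
Proof.
move=> bpsi; have [Ap _|Ap] := pselect (A p).
  by rewrite -[p]/(\val (exist _ p (mem_set Ap) : A)) !Omega_val.
rewrite le_eqVlt => /predU1P[<-|l0].
  have zM a : 0 <= (0 : R) * psi a <= 0 by rewrite mul0r lexx.
  by have := Omega_itv p zM; rewrite -eq_le mul0r => /eqP.
have blpsi : ell_infty (fun a => l * psi a).
  move: bpsi => /ell_inftyP[M psiM]; apply/ell_inftyP; exists (l * M) => a.
  by rewrite normrM gtr0_norm// ler_pM2l.
apply/eqP; rewrite eq_le; apply/andP; split.
  apply: Omega_le => // a; rewrite -mulrA ler_pM2l//; exact: le_Omega.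
rewrite mulrC -ler_pdivlMr//; apply: Omega_le => // a.
rewrite ler_pdivlMr// mulrC mulrA.
exact: (le_Omega (psi := fun a => l * psi a)).
Qed.

Lemma dist_set_gt0_notin p : 0 < dist_set p A -> ~ A p.
Proof. by move=> p0 /(dist_set_le A0 p); rewrite mdistxx; lra. Qed.

(** The triangle inequality bounds the change of both arguments of [F] by
    [mdist p q], independently of [a], so one modulus of uniform continuity of
    [F] controls all the weights simultaneously. *)
Lemma Omega_unif_away M tau e : 0 <= M -> 0 < tau -> 0 < e ->
  exists2 d, 0 < d & forall psi, (forall a, `|psi a| <= M) ->
    forall p q, tau <= dist_set p A -> tau <= dist_set q A -> mdist p q < d ->
    `|Omega A F psi p - Omega A F psi q| <= e.
Proof.
move=> M0 tau0 e0; have M1 : 0 < M + 1 by lra.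
have [d d0 dF] := extender_unif FF tau0 (divr_gt0 e0 M1).
exists d => // psi psiM p q taup tauq pq.
have bpsi : ell_infty psi by apply/ell_inftyP; exists M.
have Ap := dist_set_gt0_notin (lt_le_trans tau0 taup).
have Aq := dist_set_gt0_notin (lt_le_trans tau0 tauq).
rewrite !Omega_out//; apply: dist_sup_range a0 _ _ _;
  do ?exact: ell_infty_weighted.
move=> a; rewrite -mulrBr normrM -(divfK (lt0r_neq0 M1) e) mulrC ler_pM//.
  apply/ltW/dF; rewrite ?taup ?tauq ?dist_set_le_val//.
    have := metric_triangle (\val a) p q; have := metric_triangle (\val a) q p.
    by rewrite (metric_sym q p) ltr_norml; lra.
  have := dist_set_lip A0 p q; have := dist_set_lip A0 q p.
  by rewrite (metric_sym q p) ltr_norml; lra.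
by rewrite (le_trans (psiM a))//; lra.
Qed.

(** Upper bound: points of [A] at distance less than [d] from [b] contribute
    at most [psi b + e], and the others have weight at most [F (d / 2) t],
    which is small for small [t].  Lower bound: a point of [A] nearly closest
    to [q] lies within [d] of [b], and its weight is close to [F t t], which
    is close to 1.  The radius [r] is chosen before [psi] and [b], which is
    what makes the estimate usable for uniform continuity. *)
Lemma Omega_near_set M d e : 0 <= M -> 0 < d -> 0 < e ->
  exists2 r, 0 < r & forall psi, (forall a, 0 <= psi a <= M) ->
    forall b,
      (forall a, mdist (\val b) (\val a) < d -> `|psi b - psi a| <= e) ->
    forall q, mdist (\val b) q < r -> `|psi b - Omega A F psi q| <= 2 * e.
Proof.
move=> M0 d0 e0; have M1 : 0 < 2 * (M + 1) by lra.
(* Weights are controlled up to [e']; multiplied by values of [psi] this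
   costs at most [2 * M * e' <= e]. *)
have e'0 := divr_gt0 e0 M1; set e' := e / _ in e'0.
have Me' : 2 * (M * e') <= e.
  by rewrite -[leRHS](divfK (lt0r_neq0 M1)) -/e'; nra.
have [d1 d10 diagF] := extender_diag FF e'0.
have d20 : 0 < d / 2 by lra.
have [d2 d2_0 colF] := extender_col FF d20 e'0.
have [r [r0 rd1 rd2 rd]] : exists r, [/\ 0 < r, r <= d1, r <= d2 & 3 * r <= d].
  exists (Num.min d1 (Num.min d2 (d / 3))); split.
  - by rewrite !lt_min d10 d2_0; lra.
  - by rewrite ge_min lexx.
  - by rewrite !ge_min lexx orbT.
  - have : Num.min d1 (Num.min d2 (d / 3)) <= d / 3.
      by rewrite !ge_min lexx !orbT.
    lra.
exists r => // psi psiM b psib q bq.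
have bpsi : ell_infty psi.
  by apply/ell_inftyP; exists M => a; rewrite ger0_norm; case/andP: (psiM a).
have [Aq|Aq] := pselect (A q).
  pose a : A := exist _ q (mem_set Aq); rewrite -[q]/(\val a) Omega_val.
  have /psib : mdist (\val b) (\val a) < d by rewrite /=; lra.
  lra.
have t0 := dist_set_gt0 A0 clA Aq; set t := dist_set q A in t0.
have tr : t < r := le_lt_trans (dist_set_le_val q b) bq.
rewrite ler_norml; apply/andP; split; last first.
  (* The gap [d3] depends on [t], that is on [q]; this is harmless because it
     is only used to select the point [a]. *)
  have [d3 d30 unifF] := extender_unif FF t0 e'0.
  have min0 : 0 < Num.min d3 r by rewrite lt_min d30.
  have [x Ax qx] := dist_set_approx A0 q min0.
  pose a : A := exist _ x (mem_set Ax).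
  have qx3 : mdist q x < t + d3.
    by rewrite (lt_le_trans qx)// lerD2l ge_min lexx.
  have qxr : mdist q x < t + r.
    by rewrite (lt_le_trans qx)// lerD2l ge_min lexx orbT.
  have tx : t <= mdist x q := dist_set_le_val q a.
  have /psib : mdist (\val b) (\val a) < d.
    by have := metric_triangle (\val b) q x; rewrite /=; lra.
  have := le_Omega a Aq bpsi; rewrite -/t /=.
  have : 1 - e' < F t t by apply: diagF; rewrite t0; exact: lt_le_trans rd1.
  have : `|F t t - F (mdist x q) t| < e'.
    apply: unifF; rewrite ?lexx//.
      by rewrite ltr_norml; have := metric_sym q x; lra.
    by rewrite subrr normr0.
  have /andP[pa0 paM] := psiM a.
  rewrite ltr_norml ler_norml => /andP[_ h1] h2 h3 /andP[_ h4].
  have : psi a * (1 - F (mdist x q) t) <= M * (2 * e').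
    apply: (@le_trans _ _ (psi a * (2 * e'))).
      by rewrite ler_wpM2l//; lra.
    by rewrite ler_wpM2r//; lra.
  by rewrite mulrBr; lra.
suff : Omega A F psi q <= psi b + e by lra.
apply: Omega_le => // a; rewrite -/t.
have /andP[F0 F1] := weight_itv a Aq; rewrite -/t in F0 F1.
have /andP[pa0 paM] := psiM a; have /andP[pb0 _] := psiM b.
(* The points of [A] near [b], then those far from it. *)
have [/psib|ba] := ltP (mdist (\val b) (\val a)) d.
  rewrite ler_norml => /andP[h _].
  have : psi a * F (mdist (\val a) q) t <= psi a by rewrite ler_piMr.
  lra.
have Fe' : F (mdist (\val a) q) t <= e'.
  apply: (@le_trans _ _ (F (d / 2) t)).
    apply: extender_decr => //; first by lra.
    have := metric_triangle (\val b) q (\val a).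
    by rewrite (metric_sym q); lra.
  by apply/ltW/colF; rewrite t0; exact: lt_le_trans rd2.
have : psi a * F (mdist (\val a) q) t <= M * e' by rewrite ler_pM// ltW.
have : 0 <= M * e' by rewrite mulr_ge0// ltW.
lra.
Qed.

Lemma Omega_continuous psi M : (forall a, 0 <= psi a <= M) ->
  continuous psi -> continuous (Omega A F psi).
Proof.
move=> psiM cpsi p; apply/cvgrPdist_le => e e0.
have M0 : 0 <= M by case/andP: (psiM a0); exact: le_trans.
have npsiM a : `|psi a| <= M by rewrite ger0_norm; case/andP: (psiM a).
apply/nbhs_ballP; have [Ap|Ap] := pselect (A p).
  pose b : A := exist _ p (mem_set Ap).
  have e20 : 0 < e / 2 by lra.
  have /cvgrPdist_le/(_ _ e20)/nbhs_ballP[d /= d0 dpsi] := cpsi b.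
  have [r r0 rOm] := Omega_near_set M0 d0 e20.
  exists r => // q; rewrite ballEmdist /= => pq.
  rewrite -[p]/(\val b) Omega_val.
  have -> : e = 2 * (e / 2) by lra.
  apply: rOm => // a ba; apply: dpsi.
  suff : ball (\val b) d (\val a) by [].
  by rewrite ballEmdist.
have t0 := dist_set_gt0 A0 clA Ap; set t := dist_set p A in t0.
have t20 : 0 < t / 2 by lra.
have [d d0 dOm] := Omega_unif_away M0 t20 e0.
exists (Num.min d (t / 2)); first by rewrite /= lt_min d0.
move=> q; rewrite ballEmdist /= lt_min => /andP[pqd pqt]; apply: dOm => //.
  by rewrite -/t; lra.
by have := dist_set_lip A0 p q; rewrite -/t; lra.
Qed.

(** If [p] is close to [A], so is [q], and both values are compared with that
    of [psi] at one common point of [A] near [p]; otherwise both points are far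
    from [A]. *)
Lemma Omega_unif_continuous psi M : (forall a, 0 <= psi a <= M) ->
  unif_continuous psi -> unif_continuous (Omega A F psi).
Proof.
move=> psiM /unif_continuous_realP upsi.
apply/(unif_continuous_realP (U := X)) => e e0.
have M0 : 0 <= M by case/andP: (psiM a0); exact: le_trans.
have npsiM a : `|psi a| <= M by rewrite ger0_norm; case/andP: (psiM a).
have e50 : 0 < e / 5 by lra.
have [d d0 dpsi] := upsi _ e50.
have [r r0 rOm] := Omega_near_set M0 d0 e50.
have r60 : 0 < r / 6 by lra.
have [d' d'0 dOm] := Omega_unif_away M0 r60 e50.
exists (Num.min d' (r / 6)); first by rewrite lt_min d'0.
move=> p q; rewrite ballEmdist /= lt_min => /andP[pqd pqr].
have [pr|pr] := ltP (dist_set p A) (r / 3).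
  have r30 : 0 < r / 3 - dist_set p A by lra.
  have [x Ax px] := dist_set_approx A0 p r30.
  pose b : A := exist _ x (mem_set Ax).
  have psib a : mdist (\val b) (\val a) < d -> `|psi b - psi a| <= e / 5.
    move=> ba; apply/ltW/dpsi.
    suff : ball (\val b) d (\val a) by [].
    by rewrite ballEmdist.
  have xp : mdist (\val b) p < r by rewrite metric_sym /=; lra.
  have xq : mdist (\val b) q < r.
    by have := metric_triangle x p q; rewrite (metric_sym x p) /=; lra.
  have := rOm psi psiM b psib p xp; have := rOm psi psiM b psib q xq.
  by rewrite !ler_norml ltr_norml; lra.
have := dist_set_lip A0 p q => pq.
apply: (le_lt_trans (dOm psi npsiM p q _ _ pqd)); lra.
Qed.

End Omega.

(** * The operator on signed functions *)

Section Theta.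
Variables (R : realType) (X : metricType R) (A : set X) (F : R -> R -> R).
Hypotheses (A0 : A !=set0) (clA : closed A) (FF : tietze_extender F).
Implicit Types (phi : A -> R).

Lemma funrpos_itv phi M : (forall a, `|phi a| <= M) ->
  forall a, 0 <= phi^\+ a <= M.
Proof.
move=> phiM a; rewrite funrpos_ge0/= /funrpos ge_max.
by rewrite (le_trans (ler_norm _) (phiM a)) (le_trans _ (phiM a)).
Qed.

Lemma funrneg_itv phi M : (forall a, `|phi a| <= M) ->
  forall a, 0 <= phi^\- a <= M.
Proof.
move=> phiM; rewrite -funrposN; apply: funrpos_itv => a.
by rewrite /= normrN.
Qed.

Lemma ell_infty_funrpos phi : ell_infty phi -> ell_infty phi^\+.
Proof.
move=> /ell_inftyP[M /funrpos_itv phiM]; apply/ell_inftyP; exists M => a.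
by have /andP[? ?] := phiM a; rewrite ger0_norm.
Qed.

Lemma ell_infty_funrneg phi : ell_infty phi -> ell_infty phi^\-.
Proof.
move=> /ell_inftyP[M /funrneg_itv phiM]; apply/ell_inftyP; exists M => a.
by have /andP[? ?] := phiM a; rewrite ger0_norm.
Qed.

Lemma Theta_val phi (a : A) : Theta A F phi (\val a) = phi a.
Proof.
by rewrite /Theta /= !Omega_val -[in RHS](funrposBneg phi).
Qed.

Lemma Theta_bound phi M : (forall a, `|phi a| <= M) ->
  forall p, `|Theta A F phi p| <= M.
Proof.
move=> phiM p; have := Omega_itv A0 clA FF p (funrpos_itv phiM).
have := Omega_itv A0 clA FF p (funrneg_itv phiM).
by rewrite /Theta /= ler_norml; lra.
Qed.

Lemma Theta_lip phi psi p : ell_infty phi -> ell_infty psi ->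
  `|Theta A F phi p - Theta A F psi p| <= 2 * sup_norm (phi \- psi).
Proof.
move=> bphi bpsi.
have bD : ell_infty (phi \- psi).
  move: bphi bpsi => /ell_inftyP[M phiM] /ell_inftyP[N psiN].
  apply/ell_inftyP; exists (M + N) => a; rewrite (le_trans (ler_normB _ _))//.
  exact: lerD.
have D a : `|phi a - psi a| <= sup_norm (phi \- psi) := le_sup_norm a bD.
have := @Omega_lip _ _ _ F A0 clA FF phi^\+ psi^\+ _ p
  (ell_infty_funrpos bphi) (ell_infty_funrpos bpsi)
  (fun a => le_trans (dist_max0 (phi a) (psi a)) (D a)).
have := @Omega_lip _ _ _ F A0 clA FF phi^\- psi^\- _ p
  (ell_infty_funrneg bphi) (ell_infty_funrneg bpsi)
  (fun a => le_trans (dist_max0N (phi a) (psi a)) (D a)).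
by rewrite /Theta /= !ler_norml; lra.
Qed.

Lemma Theta_ge0 phi p : ell_infty phi -> (forall a, 0 <= phi a) ->
  0 <= Theta A F phi p.
Proof.
move=> /ell_inftyP[M phiM] phi0.
have phineg0 a : 0 <= phi^\- a <= 0.
  by rewrite (ge0_funrnegE (D := setT))/= ?lexx ?inE.
have := Omega_itv A0 clA FF p phineg0.
have := Omega_itv A0 clA FF p (funrpos_itv phiM).
by rewrite /Theta /=; lra.
Qed.

Lemma ThetaZ phi l p : ell_infty phi -> 0 <= l ->
  Theta A F (fun a => l * phi a) p = l * Theta A F phi p.
Proof.
move=> bphi l0; rewrite /Theta /= ge0_funrposM// ge0_funrnegM// mulrBr.
by rewrite !OmegaZ//; [exact: ell_infty_funrneg|exact: ell_infty_funrpos].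
Qed.

Lemma Theta_continuous phi : ell_infty phi -> continuous phi ->
  continuous (Theta A F phi).
Proof.
move=> /ell_inftyP[M phiM] cphi p.
apply: (@cvgB _ R^o); apply: Omega_continuous => //.
- exact: funrpos_itv phiM.
- by apply: continuous_lip1 cphi => x y; exact: dist_max0.
- exact: funrneg_itv phiM.
- by apply: continuous_lip1 cphi => x y; exact: dist_max0N.
Qed.

Lemma Theta_unif_continuous phi : ell_infty phi -> unif_continuous phi ->
  unif_continuous (Theta A F phi).
Proof.
move=> /ell_inftyP[M phiM] uphi; apply: (unif_continuousB (U := X)).
- apply: Omega_unif_continuous (funrpos_itv phiM) _ => //.
  by apply: unif_continuous_lip1 uphi => x y; exact: dist_max0.
- apply: Omega_unif_continuous (funrneg_itv phiM) _ => //.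
  by apply: unif_continuous_lip1 uphi => x y; exact: dist_max0N.
Qed.

End Theta.

Theorem theorem3p8 (R : realType) (X : metricType R) (A : set X)
    (F : R -> R -> R) (A_nonempty : A !=set0) (A_closed : closed A)
    (F_extender : tietze_extender F) :
  (ell_infty_operator (Theta A F) /\
   extension_operator (Theta A F)) /\
  [/\ lipschitz_operator 2 (Theta A F),
      positive_operator (Theta A F) &
      pos_homogeneous_operator (Theta A F)] /\
  [/\ preserves_norm (Theta A F),
      preserves_continuity (Theta A F) &
      preserves_unif_continuity (Theta A F)].
Proof.
have [x0 Ax0] := A_nonempty; pose a0 : A := exist _ x0 (mem_set Ax0).
have Theta_ell : ell_infty_operator (Theta A F).
  move=> phi /ell_inftyP[M phiM]; apply/ell_inftyP; exists M.
  exact: Theta_bound.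
split; [split=> //|split; split].
- by move=> phi _ a; exact: Theta_val.
- move=> phi psi bphi bpsi; apply: (sup_norm_le x0) => p; exact: Theta_lip.
- move=> _ [phi [bphi phi0] <-]; split; first exact: Theta_ell.
  by move=> p; exact: Theta_ge0.
- by move=> phi l bphi l0; apply/funext => p; exact: ThetaZ.
- move=> phi bphi; apply/eqP; rewrite eq_le; apply/andP; split.
    by apply: (sup_norm_le x0); apply: Theta_bound => // a; exact: le_sup_norm.
  apply: (sup_norm_le a0) => a; rewrite -(Theta_val F phi a).
  exact/le_sup_norm/Theta_ell.
- by move=> phi; exact: Theta_continuous.
- by move=> phi; exact: Theta_unif_continuous.
Qed.
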